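(* Let $(X,d)$ be a complete metric space and let $\Phi:X\multimap X$ be an expanding multi-valued function. Then $\Phi$ is $*$-repelling if and only if for some $k\in\mathbb N$ the number $$\delta=\inf\{d(x,y):x\in \Phi^{k}(\operatorname{Fix}(\Phi))\setminus\Phi^{k-1}(\operatorname{Fix}(\Phi)),\ y\in\mathcal F(\Phi^{-1})\}$$ is strictly positive. In this case (that is, for any $k\in\mathbb N$ whose number $\delta$ is strictly positive), for every $n\in\omega$ and the neighborhood $$E_n=\Big\{x\in X:d(x,\mathcal F(\Phi^{-1}))\le\frac{\delta}{\operatorname{Lip}(\Phi^{-1})^n}\Big\}$$ of $\mathcal F(\Phi^{-1})$ we have $$E_n\cap\Phi^\omega(\operatorname{Fix}(\Phi))=E_n\cap\Phi^{k+n}(\operatorname{Fix}(\Phi)).$$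
   Context: $\omega=\{0,1,2,\dots\}$, $\mathbb N=\{1,2,3,\dots\}$. A multi-valued function (multi-function) $\Phi:X\multimap X$ is any subset $\Phi\subset X\times X$; for $A\subset X$, $\Phi(A)=\{y\in X:\exists x\in A,\ (x,y)\in\Phi\}$ and $\Phi(x)=\Phi(\{x\})$. The inverse multi-function is $\Phi^{-1}:y\mapsto\{x\in X:y\in\Phi(x)\}$. Iterates: $\Phi^0(A)=A$, $\Phi^{n+1}(A)=\Phi(\Phi^n(A))$. The orbit of $A$ is $\Phi^\omega(A)=\bigcup_{n\in\omega}\Phi^n(A)$. $\operatorname{Fix}(\Phi)=\{x\in X:x\in\Phi(x)\}$; note $\operatorname{Fix}(\Phi)=\operatorname{Fix}(\Phi^{-1})$. The fixed fractal of a multi-function $\Psi:X\multimap X$ is the closure $\mathcal F(\Psi)=\overline{\Psi^\omega(\operatorname{Fix}(\Psi))}$ in $X$. $\Phi$ is $*$-repelling if the family $\{\Phi^{n+1}(\operatorname{Fix}(\Phi))\setminus\Phi^{n}(\operatorname{Fix}(\Phi))\}_{n\in\omega}$ is locally finite in the sense that each point $x\in X$ has a neighborhood $O_x\subset X$ that intersects only finitely many of the sets $\Phi^{n+1}(\operatorname{Fix}(\Phi))\setminus\Phi^{n}(\operatorname{Fix}(\Phi))$, $n\in\omega$. A multi-function $\Psi$ is compact-valued if each $\Psi(x)$ is compact and non-empty. For non-empty $A,B\subset X$ the Hausdorff distance is $d_H(A,B)=\max\{\sup_{a\in A}d(a,B),\sup_{b\in B}d(b,A)\}$, where $d(a,B)=\inf_{b\in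 B}d(a,b)$. $\operatorname{Lip}(\Psi)=\sup_{x\neq y}\frac{d_H(\Psi(x),\Psi(y))}{d(x,y)}$; $\Psi$ is contracting if $\operatorname{Lip}(\Psi)<1$. $\Phi$ is expanding if $\Phi^{-1}$ is compact-valued and contracting. Conventions: $\inf\emptyset=+\infty$ (which counts as strictly positive, and then $E_n=X$); $\sup\emptyset=0$ in the definition of $\operatorname{Lip}$; $0^0=1$, and $\delta/0=+\infty$ for $\delta>0$. *)

(* Defs.v *)
From mathcomp Require Export all_boot all_order all_algebra.
From mathcomp Require Export all_classical all_reals all_analysis.

Set Implicit Arguments.
Unset Strict Implicit.
Unset Printing Implicit Defensive.

Import Order.TTheory GRing.Theory Num.Theory.

Local Open Scope classical_set_scope.
Local Open Scope ring_scope.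
Local Open Scope ereal_scope.

(* A multi-function X -o X is a set (X * X); its inverse is the library's
   converse relation Phi^-1%relation. *)
Section multifunctions.
Context {X : Type}.
Implicit Types (Phi : set (X * X)) (A : set X).

Definition mimage Phi A : set X := [set y | exists2 x, A x & Phi (x, y)].

Definition mapply Phi (x : X) : set X := mimage Phi [set x].

Definition miter Phi (n : nat) A : set X := iter n (mimage Phi) A.

Definition morbit Phi A : set X := \bigcup_n miter Phi n A.

Definition mfix Phi : set X := [set x | mapply Phi x x].

(* Meaningful for n > 0: the points of the n-th iterate of the fixed set which
   are not in the previous one. *)
Definition mlayer Phi (n : nat) : set X :=
  miter Phi n (mfix Phi) `\` miter Phi n.-1 (mfix Phi).

End multifunctions.

Definition fixed_fractal {X : topologicalType} (Psi : set (X * X)) : set X :=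
  closure (morbit Psi (mfix Psi)).

Definition star_repelling {X : topologicalType} (Phi : set (X * X)) : Prop :=
  forall x : X, exists2 O : set X, nbhs x O &
    finite_set [set n : nat | mlayer Phi n.+1 `&` O !=set0].

Definition compact_valued {X : topologicalType} (Psi : set (X * X)) : Prop :=
  forall x : X, compact (mapply Psi x) /\ mapply Psi x !=set0.

(* The library's completeType is pointed; completeness is stated as a
   predicate so that the empty space is not excluded. *)
Definition complete_space (X : uniformType) : Prop :=
  forall F : set_system X, ProperFilter F -> cauchy F -> exists l : X, F --> l.

Section metric.
Context {R : realType} {X : metricType R}.
Implicit Types (Phi Psi : set (X * X)) (A B : set X).

(* ereal_inf set0 = +oo *)
Definition dist_to (x : X) A : \bar R :=
  ereal_inf [set (mdist x a)%:E | a in A].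

(* Intended for non-empty A and B. *)
Definition hausdorff_dist A B : \bar R :=
  maxe (ereal_sup [set dist_to a B | a in A])
       (ereal_sup [set dist_to b A | b in B]).

(* supremum 0 is the supremum in \bar R with the convention sup set0 = 0
   (whereas ereal_sup set0 = -oo). *)
Definition Lip Psi : \bar R :=
  supremum 0 [set hausdorff_dist (mapply Psi xy.1) (mapply Psi xy.2)
                    / (mdist xy.1 xy.2)%:E
             | xy in [set xy : X * X | xy.1 <> xy.2]].

Definition contracting Psi : Prop := Lip Psi < 1.

Definition expanding Phi : Prop :=
  compact_valued (Phi^-1)%relation /\ contracting (Phi^-1)%relation.

Definition fractal_gap Phi (k : nat) : \bar R :=
  ereal_inf [set (mdist xy.1 xy.2)%:E
            | xy in mlayer Phi k `*` fixed_fractal (Phi^-1)%relation].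

(* In \bar R, 0^-1 = +oo, +oo * +oo = +oo and x ^+ 0 = 1, so for delta > 0 the
   radius delta / Lip ^+ n is +oo as soon as delta = +oo or Lip ^+ n = 0. *)
Definition fractal_nbhd Phi (delta : \bar R) (n : nat) : set X :=
  [set x | dist_to x (fixed_fractal (Phi^-1)%relation)
           <= delta / Lip (Phi^-1)%relation ^+ n].

End metric.

(* Main.v *)
Require Import Defs.
From mathcomp Require Import ring lra zify.

Set Implicit Arguments.
Unset Strict Implicit.
Unset Printing Implicit Defensive.

Import Order.TTheory GRing.Theory Num.Theory.
Import numFieldNormedType.Exports.

Local Open Scope classical_set_scope.
Local Open Scope ring_scope.

(** The closed fractal F of Psi = Phi^-1 is carried into itself by Psi, and Psi
contracts distances by l = Lip Psi. Write L_m for the layer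
Phi^m(Fix) \ Phi^(m-1)(Fix). A point y of a layer L_m, m > 1, always has a
Psi-value in L_(m-1); so, going back from y to the layer L_k while following a
point f of F by nearest Psi-values, which stay in F, gives
  gap k <= l ^ (m - k) * d(y, f)      (fractal_gap_le)
for 0 < k <= m. This one inequality yields the inclusion of
E_n & Phi^omega(Fix) into Phi^(k+n)(Fix) (a layer beyond k + n would force a
distance larger than delta / l ^ n), and the local finiteness of the layers as
soon as some gap is positive (on a ball, l ^ (m - k) * d(y, f) tends to 0 as m
grows).

Conversely, completeness is used to show that F is compact
(fixed_fractal_compact). The orbit S of Fix under Psi is bounded, because a
large ball about any point is mapped into itself by Psi and contains Fix; and
S is contained in Psi(S), so that a finite r-net of S can be turned into a
finite (l' * r)-net for any l' > l, by taking finite nets of the compact values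
of Psi at the points of the given net. Hence S is totally bounded. If now every
gap vanished, there would be points x_n in L_n and y_n in F with
d(x_n, y_n) -> 0; every neighborhood of a cluster point of (y_n) would meet
infinitely many layers, against *-repulsion. *)

(** * Auxiliary facts on numbers *)

Lemma expr_eventually_lt (R : realType) (l r e : R) : 0 <= l < 1 -> 0 < e ->
  exists N, forall n, (N <= n)%N -> l ^+ n * r < e.
Proof.
move=> /andP[l0 l1] e0.
have /(cvg_geometric r) /cvgrPdist_lt /(_ e e0) [N _ HN] : `|l| < 1.
  by rewrite ger0_norm.
exists N => n Nn; have := HN n Nn.
rewrite /geometric /= sub0r normrN mulrC; exact: le_lt_trans (ler_norm _).
Qed.

Lemma finite_set_nat_bounded (A : set nat) : finite_set A ->
  exists N, forall n, A n -> (n < N)%N.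
Proof.
move=> /finite_seqP [s ->]; exists (\max_(n <- s) n)%N.+1 => n /= ns.
by rewrite ltnS; exact: (leq_bigmax_seq (P := xpredT) (F := id) n ns).
Qed.

(** * Iterates and layers of a multi-function *)

Section multifunction_theory.
Context {X : Type}.
Implicit Types (Phi Psi : set (X * X)) (A B : set X).

Lemma mapplyE Phi x : mapply Phi x = [set y | Phi (x, y)].
Proof.
by apply/seteqP; split => y /= => [[_ -> //]|Pxy]; exists x.
Qed.

Lemma mfixE Phi : mfix Phi = [set x | Phi (x, x)].
Proof. by apply/seteqP; split => x; rewrite /mfix /= mapplyE. Qed.

Lemma mfix_converse Phi : mfix (Phi^-1)%relation = mfix Phi.
Proof. by rewrite !mfixE. Qed.

Lemma mimageS Phi A B : A `<=` B -> mimage Phi A `<=` mimage Phi B.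
Proof. by move=> AB y [x /AB Bx Pxy]; exists x. Qed.

Lemma miter_mfixS Phi n :
  miter Phi n (mfix Phi) `<=` miter Phi n.+1 (mfix Phi).
Proof.
elim: n => [x|n IHn]; last exact: mimageS IHn.
by rewrite {1}/miter /= => fx; exists x => //; move: fx; rewrite mfixE.
Qed.

Lemma miter_mfix_le Phi m n : (m <= n)%N ->
  miter Phi m (mfix Phi) `<=` miter Phi n (mfix Phi).
Proof.
move=> /subnK <-; elim: (n - m)%N => // j IHj.
by apply: subset_trans IHj _; rewrite addSn; exact: miter_mfixS.
Qed.

Lemma morbit_mfix_image Phi :
  morbit Phi (mfix Phi) `<=` mimage Phi (morbit Phi (mfix Phi)).
Proof.
move=> y [n _ /miter_mfixS [x nx Pxy]].
by exists x => //; exists n.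
Qed.

Lemma morbit_image Phi A : mimage Phi (morbit Phi A) `<=` morbit Phi A.
Proof. by move=> y [x [n _ nx] Pxy]; exists n.+1 => //; exists x. Qed.

Lemma mlayer_nonempty Phi n y : mlayer Phi n y -> mfix Phi !=set0.
Proof.
move=> [+ _]; elim: n y => [y fy|n IHn y [x nx _]]; first by exists y.
exact: IHn nx.
Qed.

(** The orbit of the fixed set is an iterate together with the later layers. *)
Lemma mlayer_orbit Phi n y :
  morbit Phi (mfix Phi) y ->
  miter Phi n (mfix Phi) y \/ exists2 m, (n < m)%N & mlayer Phi m y.
Proof.
move=> [m _]; elim: m => [|m IHm] my.
  by left; exact: (miter_mfix_le _ my).
have [/IHm //|nmy] := pselect (miter Phi m (mfix Phi) y).
have [mn|nm] := leqP m.+1 n; first by left; exact: (miter_mfix_le _ my).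
by right; exists m.+1.
Qed.

(** Any preimage of y in Phi^(n+1)(Fix) is outside Phi^n(Fix), for otherwise y
would be in Phi^(n+1)(Fix). *)
Lemma mlayer_pred Phi n y : mlayer Phi n.+2 y ->
  exists2 x, mlayer Phi n.+1 x & Phi (x, y).
Proof.
move=> [[x nx Pxy] nny]; exists x => //; split=> // nx'.
by apply: nny; exists x.
Qed.

End multifunction_theory.

(** * Compactness and contraction in metric spaces *)

Section metric_lemmas.
Context {R : realType} {X : metricType R}.
Implicit Types (Phi Psi : set (X * X)) (A B K : set X).

Lemma mdist_continuous (u : X) : continuous (mdist u : X -> R).
Proof.
move=> x; apply/cvgrPdist_lt => e e0; near=> y.
have xy : mdist x y < e.
  by near: y; apply/metricType_numDomainType.nbhs_mdistP; exists e.
rewrite ltr_distl; apply/andP; split.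
  rewrite ltrBlDr; apply: le_lt_trans (metric_triangle _ x _) _.
  by rewrite ltrD2l.
apply: le_lt_trans (metric_triangle _ y _) _.
by rewrite ltrD2l metric_sym.
Unshelve. all: by end_near. Qed.

Lemma nbhs_mdist (x : X) A :
  nbhs x A <-> exists2 e : R, 0 < e & forall y, mdist x y < e -> A y.
Proof.
split=> [/metricType_numDomainType.nbhs_mdistP[e e0 eA]|[e e0 eA]].
  by exists e.
by apply/metricType_numDomainType.nbhs_mdistP; exists e.
Qed.

Lemma closure_mdist A (x : X) :
  closure A x <-> forall e : R, 0 < e -> exists2 a, A a & mdist x a < e.
Proof.
split=> [clx e e0|clx B /nbhs_mdist[e e0 eB]].
  have [|a [Aa xa]] := clx [set y | mdist x y < e]; last by exists a.
  by apply/nbhs_mdist; exists e.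
by have [a Aa xa] := clx e e0; exists a; split=> //; exact: eB.
Qed.

(** A is covered by finitely many closed balls of radius e; the centers are
points of the whole space, not necessarily of A. *)
Definition finite_net A (e : R) : Prop :=
  exists s : seq X, forall a, A a -> exists2 b, b \in s & mdist b a <= e.

Lemma compact_finite_net K e : compact K -> 0 < e -> finite_net K e.
Proof.
move=> cK e0.
(* the filter on finite sequences generated by the supersets of a sequence *)
pose F := filter_from [set: seq X] (fun s => [set t : seq X | {subset s <= t}]).
have FF : Filter F.
  apply: filter_from_filter; first by exists [::].
  move=> s t _ _; exists (s ++ t) => // r str; split=> x xs;
    by apply: str; rewrite mem_cat xs ?orbT.
have /compact_near_coveringP := cK.
move=> /(_ _ F (fun s a => exists2 b, b \in s & mdist b a <= e) FF) [].
  move=> x _; exists ([set y | mdist x y < e], [set t : seq X | {subset [:: x] <= t}]).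
    split=> /=; last by exists [:: x].
    by apply/nbhs_mdist; exists e.
  move=> [y t] /= [xy xt]; exists x; last exact: ltW.
  by apply: xt; rewrite inE.
by move=> s _ /(_ s) Ks; exists s; apply: Ks.
Qed.

Lemma ultrafilter_seq_cover (F : set_system X) (FU : UltraFilter F)
    (s : seq X) (e : R) :
  F [set a | exists2 b, b \in s & mdist b a < e] ->
  exists b, F [set a | mdist b a < e].
Proof.
elim: s => [|c s IHs] Fs.
  by exfalso; apply: (filter_not_empty F); apply: filterS Fs => a [].
have [Fc|Fc] := in_ultra_setVsetC [set a | mdist c a < e] FU.
  by exists c.
apply: IHs; apply: filterS (filterI Fs Fc) => a [[b]].
by rewrite inE => /orP[/eqP ->//|bs ba _]; exists b.
Qed.

Lemma closed_finite_net_compact K : complete_space X -> closed K ->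
  (forall e, 0 < e -> finite_net K e) -> compact K.
Proof.
move=> cX clK netK; rewrite compact_ultra => F FU FK.
have PF := @ultra_proper _ F FU.
have : cauchy F.
  apply: cauchy_exP => e e0; have e20 : 0 < e / 2 by rewrite divr_gt0.
  have [s sK] := netK _ e20.
  have [|b Fb] := @ultrafilter_seq_cover F FU s e.
    apply: filterS FK => a /sK [b bs ba]; exists b => //.
    by apply: le_lt_trans ba _; rewrite ltr_pdivrMr // ltr_pMr // ltr1n.
  by exists b; rewrite ballEmdist.
move=> /(cX F PF) [l Fl]; exists l; split=> //=.
apply: clK => B /Fl FB; have [a [? ?]] := filter_ex (filterI FK FB).
by exists a.
Qed.

(** Total boundedness passes to the closure. *)
Lemma finite_net_closure A :
  (forall e, 0 < e -> finite_net A e) ->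
  forall e, 0 < e -> finite_net (closure A) e.
Proof.
move=> netA e e0; have e20 : 0 < e / 2 by rewrite divr_gt0.
have [s sA] := netA _ e20; exists s => x /closure_mdist /(_ _ e20) [a Aa xa].
have [b bs ba] := sA a Aa; exists b => //.
apply: le_trans (metric_triangle _ a _) _.
by rewrite [leRHS]splitr lerD // metric_sym ltW.
Qed.

Lemma seq_mdist_bounded (x : X) (s : seq X) :
  exists2 M : R, 0 <= M & forall b, b \in s -> mdist x b <= M.
Proof.
elim: s => [|c s [M M0 IHs]]; first by exists 0.
exists (M + mdist x c); first by rewrite addr_ge0 ?mdist_ge0.
move=> b; rewrite inE => /orP[/eqP ->|/IHs bM]; first by rewrite lerDr.
by rewrite ler_wpDr // mdist_ge0.
Qed.

Lemma compact_mdist_bounded (x : X) K : compact K ->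
  exists2 M : R, 0 <= M & forall b, K b -> mdist x b <= M.
Proof.
move=> /compact_finite_net /(_ ltr01) [s sK].
have [M M0 sM] := seq_mdist_bounded x s.
exists (M + 1); first by rewrite addr_ge0.
move=> b /sK [c /sM xc cb]; apply: le_trans (metric_triangle _ c _) _.
exact: lerD.
Qed.

Lemma dist_to_ge0 (x : X) A : (0 <= dist_to x A)%E.
Proof. by apply: le_ereal_inf_tmp => _ [a _ <-]; rewrite lee_fin mdist_ge0. Qed.

Lemma hausdorff_dist_ge0 A B : A !=set0 -> (0 <= hausdorff_dist A B)%E.
Proof.
move=> [a Aa]; rewrite /hausdorff_dist le_max; apply/orP; left.
apply: le_trans (dist_to_ge0 a B) _; apply: ereal_sup_ubound.
by exists a.
Qed.

(** Pointwise form of the Lipschitz condition: each value u of Psi at x has a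
value of Psi at y at distance at most l * d(x, y). *)
Definition contracts_by (l : R) Psi : Prop := forall x y u,
  Psi (x, u) -> exists2 v, Psi (y, v) & mdist u v <= l * mdist x y.

Lemma contracting_contracts_by Psi : compact_valued Psi -> contracting Psi ->
  exists l, [/\ Lip Psi = l%:E, 0 <= l < 1 & contracts_by l Psi].
Proof.
move=> cvPsi ctPsi.
have ubL (x y : X) : x <> y ->
    (hausdorff_dist (mapply Psi x) (mapply Psi y) / (mdist x y)%:E <= Lip Psi)%E.
  move=> xy; apply: ge_supremum_Nmem; first exact: ereal_supremums_neq0.
  by exists (x, y).
have L0 : (0 <= Lip Psi)%E.
  have [[[x y] xy]|nS] := pselect (exists xy : X * X, xy.1 <> xy.2).
    apply: le_trans (ubL x y xy).
    rewrite mule_ge0 ?inve_ge0 ?lee_fin ?mdist_ge0 //.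
    by apply: hausdorff_dist_ge0; exact: (cvPsi x).2.
  rewrite /Lip (_ : [set xy | _] = set0) ?image_set0 ?supremum0 //.
  by apply/seteqP; split=> // xy ?; apply: nS; exists xy.
have Lfin : Lip Psi \is a fin_num.
  by rewrite ge0_fin_numE //; apply: lt_trans ctPsi _; rewrite ltry.
exists (fine (Lip Psi)); split; first by rewrite fineK.
  by rewrite fine_ge0 //= -lte_fin fineK.
move=> x y u Pxu; have [xy|/eqP xy] := eqVneq x y.
  by exists u; rewrite -?xy // !mdistxx mulr0.
have [cPy Py0] := cvPsi y.
(* compactness of Psi(y) gives a nearest point, so that the constant is the
   Lipschitz constant itself *)
have [|v Pyv vmin] := @compact_EVT_min X R (mdist u) _ Py0 cPy.
  by apply: continuous_subspaceT; exact: mdist_continuous.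
move: Pyv; rewrite inE mapplyE /= => Pyv.
exists v => //; rewrite -lee_fin EFinM fineK //.
have d0 : (0 < mdist x y)%R by rewrite mdist_gt0; apply/eqP.
rewrite -lee_pdivrMr //; apply: le_trans (ubL x y xy).
rewrite inver gt_eqF //; apply: lee_wpmul2r.
  by rewrite lee_fin invr_ge0 ltW.
apply: (@le_trans _ _ (dist_to u (mapply Psi y))).
  apply: le_ereal_inf_tmp => _ [a Pya <-].
  by rewrite lee_fin vmin // inE.
rewrite /hausdorff_dist le_max; apply/orP; left; apply: ereal_sup_ubound.
by exists u; rewrite // mapplyE.
Qed.

End metric_lemmas.

(** * The fixed fractal of a contracting multi-function *)

Section expanding_theory.
Context {R : realType} {X : metricType R}.
Implicit Types (Phi Psi : set (X * X)) (A : set X).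

Lemma mfix_fixed_fractal Phi : mfix Phi `<=` fixed_fractal (Phi^-1)%relation.
Proof.
move=> x fx; apply: subset_closure; exists 0%N => //.
by rewrite /miter /= mfix_converse.
Qed.

Lemma mlayer_fixed_fractal_nonempty Phi n y :
  mlayer Phi n y -> fixed_fractal (Phi^-1)%relation !=set0.
Proof.
by move=> ly; have [x fx] := mlayer_nonempty ly; exists x; exact: mfix_fixed_fractal.
Qed.

(** The fixed fractal is invariant under Psi, because a value of Psi at f is
approximated by values at points of the orbit near f. *)
Lemma fixed_fractal_step Psi l y f u : 0 <= l -> contracts_by l Psi ->
  fixed_fractal Psi f -> Psi (y, u) ->
  exists2 v, fixed_fractal Psi v & mdist u v <= l * mdist y f.
Proof.
move=> l0 lPsi Ff Pyu; have [v Pfv uv] := lPsi _ f _ Pyu.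
exists v => //; apply/closure_mdist => e e0.
have l10 : 0 < l + 1 by rewrite ltr_wpDl.
have [a Sa fa] := (closure_mdist _ _).1 Ff _ (divr_gt0 e0 l10).
have [w Paw vw] := lPsi f a v Pfv; exists w.
  by apply: morbit_image; exists a.
apply: le_lt_trans vw _; apply: (@le_lt_trans _ _ (l * (e / (l + 1)))).
  by rewrite ler_wpM2l // ltW.
by rewrite mulrCA gtr_pMr // ltr_pdivrMr // mul1r ltrDl.
Qed.

(** Following y back through j layers and f through values of Phi^-1
simultaneously. *)
Lemma mlayer_descend Phi l k j y f : 0 <= l ->
  contracts_by l (Phi^-1)%relation ->
  mlayer Phi (j + k.+1) y -> fixed_fractal (Phi^-1)%relation f ->
  exists x g, [/\ mlayer Phi k.+1 x, fixed_fractal (Phi^-1)%relation g &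
                  mdist x g <= l ^+ j * mdist y f].
Proof.
move=> l0 lPsi; elim: j y f => [|j IHj] y f ly Ff.
  by exists y, f; split=> //; rewrite expr0 mul1r.
rewrite addSn addnS in ly; have [z lz Pzy] := mlayer_pred ly.
have [v Fv zv] := fixed_fractal_step l0 lPsi Ff (Pzy : Phi^-1%relation (y, z)).
have [| |x [g [lx Fg xg]]] := IHj z v; rewrite ?addnS //.
exists x, g; split=> //; apply: le_trans xg _.
by rewrite exprSr -mulrA ler_wpM2l // exprn_ge0.
Qed.

Lemma fractal_gap_le Phi l k m y f : 0 <= l ->
  contracts_by l (Phi^-1)%relation -> (0 < k <= m)%N ->
  mlayer Phi m y -> fixed_fractal (Phi^-1)%relation f ->
  (fractal_gap Phi k <= (l ^+ (m - k) * mdist y f)%:E)%E.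
Proof.
move=> l0 lPsi /andP[k0 km] ly Ff.
have km' : (m - k + k.-1.+1)%N = m by rewrite prednK // subnK.
rewrite -km' in ly.
have [x [g [lx Fg xg]]] := mlayer_descend l0 lPsi ly Ff.
rewrite prednK // in lx.
apply: ge_ereal_inf; exists (mdist x g)%:E; last by rewrite lee_fin.
by exists (x, g).
Qed.

Lemma morbit_mfix_bounded Psi l x0 : 0 <= l < 1 -> contracts_by l Psi ->
  compact (mapply Psi x0) ->
  exists2 C : R, 0 <= C & forall y, morbit Psi (mfix Psi) y -> mdist x0 y <= C.
Proof.
move=> /andP[l0 l1] lPsi /(compact_mdist_bounded x0) [M M0 KM].
have l10 : 0 < 1 - l by rewrite subr_gt0.
(* C is the fixed point of r |-> M + l * r, so Psi maps the closed ball of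
   radius C about x0 to itself *)
pose C := M / (1 - l); have CE : M + l * C = C.
  by rewrite /C; field; rewrite gt_eqF.
have step z w : Psi (z, w) -> mdist x0 w <= M + l * mdist x0 z.
  move=> /(lPsi z x0) [v Pv wv].
  apply: le_trans (metric_triangle _ v _) _; apply: lerD.
    by apply: KM; rewrite mapplyE.
  by rewrite metric_sym (metric_sym x0).
exists C; first by rewrite divr_ge0 // ltW.
move=> y [n _]; elim: n y => [y|n IHn y [z /IHn zC Pzy]].
  rewrite /miter /= mfixE => /step; rewrite -lerBlDr => yM.
  rewrite /C ler_pdivlMr //; lra.
apply: le_trans (step _ _ Pzy) _; rewrite -CE lerD2l.
by rewrite ler_wpM2l.
Qed.

(** A contracting multi-function with compact values turns finite r-nets of a set
contained in its own image into finite (l' * r)-nets, l' being any number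
above the contraction factor. *)
Lemma finite_net_contract Psi A l l' r : 0 <= l < l' -> 0 < r ->
  contracts_by l Psi -> (forall x, compact (mapply Psi x)) ->
  A `<=` mimage Psi A -> finite_net A r -> finite_net A (l' * r).
Proof.
move=> /andP[l0 ll'] r0 lPsi cPsi AA [s sA].
have e0 : 0 < (l' - l) * r by rewrite mulr_gt0 // subr_gt0.
have [t tP] := choice (fun b => compact_finite_net (cPsi b) e0).
exists (flatten [seq t b | b <- s]) => a /AA [z Az Pza].
have [b bs bz] := sA z Az; have [v Pbv av] := lPsi z b a Pza.
have [|c ct cv] := tP b v; first by rewrite mapplyE.
exists c; first by apply/flatten_mapP; exists b.
apply: le_trans (metric_triangle _ v _) _.
rewrite -[l'](subrK l) mulrDl lerD // metric_sym.
by apply: le_trans av _; rewrite ler_wpM2l // metric_sym.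
Qed.

Lemma fixed_fractal_compact Psi l : complete_space X -> 0 <= l < 1 ->
  contracts_by l Psi -> (forall x, compact (mapply Psi x)) ->
  compact (fixed_fractal Psi).
Proof.
move=> cX l01 lPsi cPsi; have /andP[l0 l1] := l01.
apply: closed_finite_net_compact => //; first exact: closed_closure.
apply: finite_net_closure => e e0.
have [[x0 Fx0]|nF] := pselect (mfix Psi !=set0); last first.
  exists [::] => a [n _ na]; exfalso; apply: nF; elim: n a na => [a|n IHn a].
    by exists a.
  by move=> [z /IHn].
have [C C0 SC] := morbit_mfix_bounded l01 lPsi (cPsi x0).
pose l' := (1 + l) / 2.
have l'01 : 0 <= l' < 1 by apply/andP; rewrite /l'; split; lra.
have ll' : 0 <= l < l' by apply/andP; rewrite /l'; split; lra.
have net n : finite_net (morbit Psi (mfix Psi)) (l' ^+ n * (C + 1)).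
  elim: n => [|n IHn].
    exists [:: x0] => a /SC x0a; exists x0; first by rewrite inE.
    by rewrite expr0 mul1r ler_wpDr.
  rewrite exprS -mulrA.
  apply: (finite_net_contract ll' _ lPsi cPsi (@morbit_mfix_image _ Psi) IHn).
  rewrite mulr_gt0 ?exprn_gt0 //; last by rewrite ltr_wpDl.
  by rewrite /l'; lra.
have [N NP] := expr_eventually_lt (C + 1) l'01 e0.
have [s sA] := net N; exists s => a /sA [b bs ba]; exists b => //.
by apply: le_trans ba _; rewrite ltW // NP.
Qed.

Lemma star_repelling_fractal_gap Phi : compact (fixed_fractal (Phi^-1)%relation) ->
  star_repelling Phi -> exists k : nat, (0 < k)%N /\ (0 < fractal_gap Phi k)%E.
Proof.
move=> cF sPhi; apply: contrapT => nk.
have gap0 n : (fractal_gap Phi n.+1 < (n.+1%:R^-1 : R)%:E)%E.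
  apply: (@le_lt_trans _ _ 0%E); last by rewrite lte_fin invr_gt0.
  by rewrite leNgt; apply/negP => gk; apply: nk; exists n.+1.
(* p n is a pair in L_(n+1) * F at distance less than 1 / (n + 1) *)
have /choice[p pP] : forall n, exists p : X * X,
    [/\ mlayer Phi n.+1 p.1, fixed_fractal (Phi^-1)%relation p.2 &
        mdist p.1 p.2 < n.+1%:R^-1].
  move=> n; have [_ [p [lp Fp] <-]] := ereal_inf_lt (gap0 n).
  by rewrite lte_fin => ?; exists p.
have [|y [Fy yp]] := cF ((fun n => (p n).2) @ \oo) _.
  by exists 0%N => // n _; have [] := pP n.
have [U /nbhs_mdist[e e0 eU] /finite_set_nat_bounded [N NP]] := sPhi y.
have e20 : 0 < e / 2 by rewrite divr_gt0.
have [M _ MP] := near_infty_natSinv_lt (PosNum e20).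
have [| |z [[n /= nMN <-] yn]] := yp [set (p n).2 | n in [set n | (maxn M N <= n)%N]]
    [set z | mdist y z < e / 2].
- by exists (maxn M N) => // n /= Mn; exists n.
- by apply/nbhs_mdist; exists (e / 2).
have [ln _ dn] := pP n.
have Un : mlayer Phi n.+1 `&` U !=set0.
  exists (p n).1; split=> //; apply: eU.
  apply: le_lt_trans (metric_triangle _ (p n).2 _) _.
  rewrite [ltRHS]splitr ltrD // metric_sym; apply: lt_trans dn _.
  by apply: MP => /=; rewrite (leq_trans (leq_maxl M N)).
by have := NP n Un; rewrite ltnNge (leq_trans (leq_maxr M N)).
Qed.

Lemma fractal_gap_star_repelling Phi l k : 0 <= l < 1 ->
  contracts_by l (Phi^-1)%relation -> (0 < k)%N -> (0 < fractal_gap Phi k)%E ->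
  star_repelling Phi.
Proof.
move=> l01 lPsi k0 gk x; have /andP[l0 l1] := l01.
exists [set y | mdist x y < 1]; first by apply/nbhs_mdist; exists 1.
set A := [set n | _].
have [[m [y [ly _]]]|nA] := pselect (A !=set0); last first.
  by rewrite (_ : A = set0) //; apply/seteqP; split=> // n An; apply: nA; exists n.
have [f Ff] := mlayer_fixed_fractal_nonempty ly.
have [e e0 ek] : exists2 e : R, 0 < e & (e%:E <= fractal_gap Phi k)%E.
  case: (fractal_gap Phi k) gk => [r||//]; last by exists 1; rewrite // leey.
  by rewrite lte_fin => r0; exists r.
(* points of the ball are at distance at most 1 + d(x, f) from f *)
have [N NP] := expr_eventually_lt (1 + mdist x f) l01 e0.
apply: (@sub_finite_set _ _ `I_(k + N)); last exact: finite_II.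
move=> n [z [lz /= xz]]; rewrite ltnNge; apply/negP => kNn.
have kn : (k <= n.+1)%N by lia.
have := fractal_gap_le l0 lPsi (_ : (0 < k <= n.+1)%N) lz Ff.
rewrite k0 kn => /(_ isT) /(le_trans ek); rewrite lee_fin leNgt => /negP; apply.
apply: le_lt_trans (NP (n.+1 - k)%N _); last by lia.
rewrite ler_wpM2l ?exprn_ge0 //; apply: le_trans (metric_triangle _ x _) _.
by rewrite lerD2r metric_sym ltW.
Qed.

Lemma fractal_nbhd_set_nbhs Phi l (d : \bar R) n : 0 <= l ->
  Lip (Phi^-1)%relation = l%:E -> (0 < d)%E ->
  set_nbhs (fixed_fractal (Phi^-1)%relation) (fractal_nbhd Phi d n).
Proof.
move=> l0 Ll d0 f Ff.
have rho0 : (0 < d / Lip (Phi^-1)%relation ^+ n)%E.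
  rewrite Ll -EFin_expe inver; case: eqVneq => [_|ln0].
    by rewrite gt0_muley // ltry.
  by rewrite mule_gt0 // lte_fin invr_gt0 lt_neqAle eq_sym ln0 exprn_ge0.
have [e e0 er] : exists2 e : R, 0 < e & (e%:E <= d / Lip (Phi^-1)%relation ^+ n)%E.
  case: (d / _)%E rho0 => [r||//]; last by exists 1; rewrite // leey.
  by rewrite lte_fin => r0; exists r.
apply/nbhs_mdist; exists e => // y fy; apply: le_trans er.
apply: ge_ereal_inf; exists (mdist y f)%:E; first by exists f.
by rewrite lee_fin metric_sym ltW.
Qed.

Lemma fractal_nbhd_orbit Phi l k n : 0 <= l < 1 ->
  contracts_by l (Phi^-1)%relation -> Lip (Phi^-1)%relation = l%:E ->
  (0 < k)%N -> (0 < fractal_gap Phi k)%E ->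
  fractal_nbhd Phi (fractal_gap Phi k) n `&` morbit Phi (mfix Phi) =
  fractal_nbhd Phi (fractal_gap Phi k) n `&` miter Phi (k + n) (mfix Phi).
Proof.
move=> /andP[l0 l1] lPsi Ll k0; set g := fractal_gap Phi k => g0.
apply/seteqP; split=> y [Ey oy]; split=> //; last by exists (k + n)%N.
have [//|[m knm ly]] := mlayer_orbit (k + n) oy.
exfalso.
have km : (0 < k <= m)%N by lia.
have [f Ff] := mlayer_fixed_fractal_nonempty ly.
have gle h : fixed_fractal (Phi^-1)%relation h ->
    (g <= (l ^+ (m - k) * mdist y h)%:E)%E.
  exact: fractal_gap_le.
(* F is not empty, so the gap is finite *)
case: g g0 gle Ey => [d||//] + gle; last by have := gle f Ff; rewrite leye_eq.
rewrite lte_fin => d0; rewrite /fractal_nbhd /= Ll -EFin_expe.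
(* l = 0 would make the gap zero, as m - k > 0 *)
have {}l0 : 0 < l.
  rewrite lt_neqAle l0 andbT; apply/eqP => l0'; have := gle f Ff.
  by rewrite -l0' expr0n (_ : (m - k == 0)%N = false) ?mul0r ?lee_fin ?leNgt ?d0 //; lia.
have lp j : 0 < l ^+ j by rewrite exprn_gt0.
rewrite inver gt_eqF // -EFinM => Ey.
have : (d / l ^+ (m - k)) <= d / l ^+ n.
  rewrite -lee_fin; apply: le_trans Ey; apply: le_ereal_inf_tmp => _ [h Fh <-].
  by rewrite lee_fin ler_pdivrMr // mulrC -lee_fin gle.
rewrite ler_pM2l // lef_pV2 ?posrE // leNgt => /negP; apply.
rewrite ltr_iXn2l //; lia.
Qed.

End expanding_theory.

Theorem theorem2 (R : realType) (X : metricType R) (Phi : set (X * X))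
  (cX : complete_space X) (ePhi : expanding Phi) :
  (star_repelling Phi <->
     exists k : nat, (0 < k)%N /\ (0 < fractal_gap Phi k)%E)
  /\
  (forall k : nat, (0 < k)%N -> (0 < fractal_gap Phi k)%E ->
   forall n : nat,
     let E := fractal_nbhd Phi (fractal_gap Phi k) n in
     set_nbhs (fixed_fractal (Phi^-1)%relation) E /\
     E `&` morbit Phi (mfix Phi) = E `&` miter Phi (k + n) (mfix Phi)).
Proof.
have [cvPsi ctPsi] := ePhi.
have [l [Ll l01 lPsi]] := contracting_contracts_by cvPsi ctPsi.
have cF : compact (fixed_fractal (Phi^-1)%relation).
  by apply: (fixed_fractal_compact cX l01 lPsi) => x; exact: (cvPsi x).1.
split=> [|k k0 gk n E]; last split.
- split=> [|[k [k0 gk]]]; first exact: star_repelling_fractal_gap.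
  exact: fractal_gap_star_repelling l01 lPsi k0 gk.
- by have /andP[l0 _] := l01; exact: fractal_nbhd_set_nbhs n l0 Ll gk.
- exact: fractal_nbhd_orbit l01 lPsi Ll k0 gk.
Qed.
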